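(* Let $K$ be a field and let $L_\infty$ be the Leibniz $K$-algebra with basis $\{e_1,e_2,\dots\}$ and multiplication $e_ie_1=e_{i+1}$ for all $i\ge1$, all other products of basis elements being zero. Let $f(x_1,\dots,x_m)\in\mathcal D(X)$ be a multilinear polynomial in the variables $x_1,\dots,x_m$. Then the image of $f$ on $L_\infty$ is $\{0\}$, $(L_\infty)^m$ or $(L_\infty)^{m+1}$. In particular, the image of $f$ is a vector subspace of $L_\infty$.
   Context: A Leibniz algebra over $K$ is a (not necessarily associative) $K$-algebra satisfying $x(yz)=(xy)z-(xz)y$ for all $x,y,z$. For a Leibniz algebra $L$ put $L^1=L$ and $L^{k+1}=L^kL$. $\mathcal D(X)$ is the free Leibniz $K$-algebra on $X=\{x_1,x_2,\dots\}$; its elements are called polynomials. A polynomial in $x_1,\dots,x_m$ is multilinear if it is a linear combination of the left-normed monomials $(\cdots(x_{\sigma(1)}x_{\sigma(2)})\cdots)x_{\sigma(m)}$, $\sigma\in S_m$. The image of $f(x_1,\dots,x_m)$ on $L$ is $\{f(a_1,\dots,a_m): a_1,\dots,a_m\in L\}$. *)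

(* Defs.v *)
From HB Require Import structures.
From mathcomp Require Import all_boot all_order all_algebra all_fingroup.
From mathcomp Require Import generic_quotient sesquilinear.
From mathcomp Require Import boolp classical_sets.

Set Implicit Arguments.
Unset Strict Implicit.
Unset Printing Implicit Defensive.

Import GRing.Theory.
Local Open Scope ring_scope.
Local Open Scope quotient_scope.
Local Open Scope classical_set_scope.

(* Right Leibniz algebras: right multiplications are derivations. *)
HB.mixin Record isLeibniz (K : fieldType) L of GRing.Lmodule K L := {
  lmul : L -> L -> L;
  lmul_bilinear : bilinear_for *:%R *:%R lmul;
  lmul_leibniz : forall x y z : L,
    lmul x (lmul y z) = lmul (lmul x y) z - lmul (lmul x z) y
}.

#[short(type="leibnizType")]
HB.structure Definition Leibniz (K : fieldType) :=
  {L of GRing.Lmodule K L & isLeibniz K L}.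

Section LeibnizTheory.
Context {K : fieldType} {L : leibnizType K}.
Implicit Types (x y z : L) (A : set L).

Lemma lmulDl x y z : lmul (x + y) z = lmul x z + lmul y z.
Proof. by have /= := lmul_bilinear.1 z 1 x y; rewrite !scale1r. Qed.

Lemma lmulDr x y z : lmul z (x + y) = lmul z x + lmul z y.
Proof. by have /= := lmul_bilinear.2 z 1 x y; rewrite !scale1r. Qed.

Lemma lmul0l z : lmul 0 z = 0 :> L.
Proof. by apply: (addrI (lmul 0 z)); rewrite -lmulDl !addr0. Qed.

Lemma lmul0r z : lmul z 0 = 0 :> L.
Proof. by apply: (addrI (lmul z 0)); rewrite -lmulDr !addr0. Qed.

Lemma lmulZl a x z : lmul (a *: x) z = a *: lmul x z.
Proof. by have /= := lmul_bilinear.1 z a x 0; rewrite lmul0l !addr0. Qed.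

Lemma lmulZr a x z : lmul z (a *: x) = a *: lmul z x.
Proof. by have /= := lmul_bilinear.2 z a x 0; rewrite lmul0r !addr0. Qed.

End LeibnizTheory.

Definition vsubspace (K : fieldType) (V : lmodType K) (A : set V) : Prop :=
  submod_closed (mem A).

Definition lspan (K : fieldType) (V : lmodType K) (A : set V) : set V :=
  smallest (@vsubspace K V) A.

(* [lpow L k] is L^k for k >= 1; the value at k = 0 is a dummy. *)
Definition lpow (K : fieldType) (L : leibnizType K) (k : nat) : set L :=
  iter k.-1 (fun A : set L => lspan [set lmul u v | u in A & v in [set: L]])
    [set: L].

Arguments lpow {K} L k.

(* The free Leibniz algebra on countably many generators, as the quotient of
   the terms in the signature of K-algebras by the congruence generated by the
   axioms of Leibniz algebras. *)
Inductive lterm (K : Type) : Type :=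
| LVar of nat
| LZero
| LAdd of lterm K & lterm K
| LScale of K & lterm K
| LMul of lterm K & lterm K.

Arguments LVar {K}.
Arguments LZero {K}.

HB.instance Definition _ (K : Type) := gen_eqMixin (lterm K).
HB.instance Definition _ (K : Type) := gen_choiceMixin (lterm K).

Inductive lterm_eq (K : fieldType) : lterm K -> lterm K -> Prop :=
| lteq_refl s : lterm_eq s s
| lteq_sym s t : lterm_eq s t -> lterm_eq t s
| lteq_trans t s u : lterm_eq s t -> lterm_eq t u -> lterm_eq s u
| lteq_add s s' t t' :
    lterm_eq s s' -> lterm_eq t t' -> lterm_eq (LAdd s t) (LAdd s' t')
| lteq_scale a s s' : lterm_eq s s' -> lterm_eq (LScale a s) (LScale a s')
| lteq_mul s s' t t' :
    lterm_eq s s' -> lterm_eq t t' -> lterm_eq (LMul s t) (LMul s' t')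
| lteq_addA s t u : lterm_eq (LAdd s (LAdd t u)) (LAdd (LAdd s t) u)
| lteq_addC s t : lterm_eq (LAdd s t) (LAdd t s)
| lteq_add0 s : lterm_eq (LAdd LZero s) s
| lteq_addN s : lterm_eq (LAdd (LScale (-1) s) s) LZero
| lteq_scaleA a b s : lterm_eq (LScale a (LScale b s)) (LScale (a * b) s)
| lteq_scale1 s : lterm_eq (LScale 1 s) s
| lteq_scaleDr a s t :
    lterm_eq (LScale a (LAdd s t)) (LAdd (LScale a s) (LScale a t))
| lteq_scaleDl a b s :
    lterm_eq (LScale (a + b) s) (LAdd (LScale a s) (LScale b s))
| lteq_mulDl s t u : lterm_eq (LMul (LAdd s t) u) (LAdd (LMul s u) (LMul t u))
| lteq_mulDr s t u : lterm_eq (LMul u (LAdd s t)) (LAdd (LMul u s) (LMul u t))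
| lteq_mulZl a s t : lterm_eq (LMul (LScale a s) t) (LScale a (LMul s t))
| lteq_mulZr a s t : lterm_eq (LMul s (LScale a t)) (LScale a (LMul s t))
| lteq_leibniz s t u :
    lterm_eq (LMul s (LMul t u))
      (LAdd (LMul (LMul s t) u) (LScale (-1) (LMul (LMul s u) t))).

Section FreeLeibniz.
Context (K : fieldType).
Implicit Types s t u : lterm K.

Definition lterm_eqb s t : bool := `[< lterm_eq s t >].

Lemma lterm_eqb_refl : reflexive lterm_eqb.
Proof. by move=> s; apply/asboolP; exact: lteq_refl. Qed.

Lemma lterm_eqb_sym : symmetric lterm_eqb.
Proof.
by move=> s t; apply/asboolP/asboolP => h; exact: lteq_sym.
Qed.

Lemma lterm_eqb_trans : transitive lterm_eqb.
Proof.
by move=> t s u /asboolP st /asboolP tu; apply/asboolP; exact: lteq_trans tu.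
Qed.

Canonical lterm_eqb_equiv :=
  EquivRel lterm_eqb lterm_eqb_refl lterm_eqb_sym lterm_eqb_trans.

Definition freeLeibniz : Type := {eq_quot lterm_eqb}.
HB.instance Definition _ := Choice.on freeLeibniz.

Let D := freeLeibniz.
Definition fl_class (t : lterm K) : D := \pi_{eq_quot lterm_eqb} t.
Definition fl_repr (x : D) : lterm K := repr (x : {eq_quot lterm_eqb}).

Lemma fl_reprK : cancel fl_repr fl_class.
Proof. by move=> x; rewrite /fl_class /fl_repr reprK. Qed.

Lemma fl_classP s t : fl_class s = fl_class t <-> lterm_eq s t.
Proof.
rewrite /fl_class; split=> [/eqmodP/asboolP //|h].
by apply/eqmodP/asboolP.
Qed.

Lemma fl_reprP t : lterm_eq (fl_repr (fl_class t)) t.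
Proof. by apply/fl_classP; rewrite fl_reprK. Qed.

Definition fl_zero : D := fl_class LZero.
Definition fl_add (x y : D) : D := fl_class (LAdd (fl_repr x) (fl_repr y)).
Definition fl_scale (a : K) (x : D) : D := fl_class (LScale a (fl_repr x)).
Definition fl_mul (x y : D) : D := fl_class (LMul (fl_repr x) (fl_repr y)).

Lemma fl_addE s t : fl_add (fl_class s) (fl_class t) = fl_class (LAdd s t).
Proof. by apply/fl_classP/lteq_add; exact: fl_reprP. Qed.
Lemma fl_scaleE a t : fl_scale a (fl_class t) = fl_class (LScale a t).
Proof. by apply/fl_classP/lteq_scale/fl_reprP. Qed.
Lemma fl_mulE s t : fl_mul (fl_class s) (fl_class t) = fl_class (LMul s t).
Proof. by apply/fl_classP/lteq_mul; exact: fl_reprP. Qed.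

Let flE := (fl_addE, fl_scaleE, fl_mulE).

Fact fl_addA : associative fl_add.
Proof.
move=> x y z; rewrite -(fl_reprK x) -(fl_reprK y) -(fl_reprK z) !flE.
by apply/fl_classP; constructor.
Qed.
Fact fl_addC : commutative fl_add.
Proof.
move=> x y; rewrite -(fl_reprK x) -(fl_reprK y) !flE.
by apply/fl_classP; exact: lteq_addC.
Qed.
Fact fl_add0 : left_id fl_zero fl_add.
Proof.
by move=> x; rewrite -(fl_reprK x) !flE; apply/fl_classP; exact: lteq_add0.
Qed.
Fact fl_addN : left_inverse fl_zero (fl_scale (-1)) fl_add.
Proof.
by move=> x; rewrite -(fl_reprK x) !flE; apply/fl_classP; exact: lteq_addN.
Qed.
HB.instance Definition _ :=
  GRing.isZmodule.Build freeLeibniz fl_addA fl_addC fl_add0 fl_addN.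

Fact fl_scaleA a b (x : D) : fl_scale a (fl_scale b x) = fl_scale (a * b) x.
Proof. by rewrite -(fl_reprK x) !flE; apply/fl_classP; exact: lteq_scaleA. Qed.
Fact fl_scale1 : left_id 1 fl_scale.
Proof.
by move=> x; rewrite -(fl_reprK x) !flE; apply/fl_classP; exact: lteq_scale1.
Qed.
Fact fl_scaleDr : right_distributive fl_scale +%R.
Proof.
move=> a x y; rewrite -(fl_reprK x) -(fl_reprK y) /GRing.add /= !flE.
by apply/fl_classP; exact: lteq_scaleDr.
Qed.
Fact fl_scaleDl (x : D) : {morph fl_scale^~ x : a b / a + b}.
Proof.
move=> a b; rewrite -(fl_reprK x) [RHS]/GRing.add /= !flE.
by apply/fl_classP; exact: lteq_scaleDl.
Qed.
HB.instance Definition _ := GRing.Zmodule_isLmodule.Build K freeLeibniz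
  fl_scaleA fl_scale1 fl_scaleDr fl_scaleDl.

Lemma fl_class0 : fl_class LZero = 0 :> D. Proof. by []. Qed.
Lemma fl_classD s t : fl_class (LAdd s t) = fl_class s + fl_class t :> D.
Proof. by rewrite -fl_addE. Qed.
Lemma fl_classZ a t : fl_class (LScale a t) = a *: (fl_class t : D).
Proof. by rewrite -fl_scaleE. Qed.

Fact fl_mul_bilinear : bilinear_for *:%R *:%R (fl_mul : D -> D -> D).
Proof.
split=> z a x y /=.
  rewrite -(fl_reprK x) -(fl_reprK y) -(fl_reprK z).
  rewrite -fl_classZ -fl_classD !fl_mulE -fl_classZ -fl_classD.
  apply/fl_classP; apply: lteq_trans (lteq_mulDl _ _ _) _.
  by apply: lteq_add; [exact: lteq_mulZl|exact: lteq_refl].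
rewrite -(fl_reprK x) -(fl_reprK y) -(fl_reprK z).
rewrite -fl_classZ -fl_classD !fl_mulE -fl_classZ -fl_classD.
apply/fl_classP; apply: lteq_trans (lteq_mulDr _ _ _) _.
by apply: lteq_add; [exact: lteq_mulZr|exact: lteq_refl].
Qed.

Fact fl_mul_leibniz (x y z : D) :
  fl_mul x (fl_mul y z) = fl_mul (fl_mul x y) z - fl_mul (fl_mul x z) y.
Proof.
rewrite -(fl_reprK x) -(fl_reprK y) -(fl_reprK z) !fl_mulE.
rewrite -scaleN1r -fl_classZ -fl_classD.
by apply/fl_classP; exact: lteq_leibniz.
Qed.
HB.instance Definition _ :=
  isLeibniz.Build K freeLeibniz fl_mul_bilinear fl_mul_leibniz.

(* Variables are numbered from 0: [lvar i] is x_{i+1}. *)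
Definition lvar (i : nat) : freeLeibniz := fl_class (LVar i).

End FreeLeibniz.

Section Evaluation.
Context {K : fieldType} {L : leibnizType K}.
Implicit Types (g : nat -> L) (f : freeLeibniz K).

Fixpoint lterm_eval g (t : lterm K) : L :=
  match t with
  | LVar i => g i
  | LZero => 0
  | LAdd s u => lterm_eval g s + lterm_eval g u
  | LScale a s => a *: lterm_eval g s
  | LMul s u => lmul (lterm_eval g s) (lterm_eval g u)
  end.

Lemma lterm_eval_eq g s t :
  lterm_eq s t -> lterm_eval g s = lterm_eval g t.
Proof.
elim=> //=.
- by move=> ? ? ? _ -> _ ->.
- by move=> ? ? ? ? _ -> _ ->.
- by move=> ? ? ? _ ->.
- by move=> ? ? ? ? _ -> _ ->.
- by move=> *; rewrite addrA.
- by move=> *; rewrite addrC.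
- by move=> *; rewrite add0r.
- by move=> *; rewrite scaleN1r addNr.
- by move=> *; rewrite scalerA.
- by move=> *; rewrite scale1r.
- by move=> *; rewrite scalerDr.
- by move=> *; rewrite scalerDl.
- by move=> *; rewrite lmulDl.
- by move=> *; rewrite lmulDr.
- by move=> *; rewrite lmulZl.
- by move=> *; rewrite lmulZr.
- by move=> *; rewrite lmul_leibniz scaleN1r.
Qed.

(* The substitution x_{i+1} := g i; the lemmas below show that it is the unique
   homomorphism with these values on the generators. *)
Definition leval g f : L := lterm_eval g (fl_repr f).

Lemma leval_class g (t : lterm K) : leval g (fl_class t) = lterm_eval g t.
Proof. exact/lterm_eval_eq/fl_reprP. Qed.

Lemma leval_var g i : leval g (lvar K i) = g i.
Proof. exact: leval_class. Qed.

Fact leval_linear g : linear (leval g).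
Proof.
move=> a x y; rewrite -(fl_reprK x) -(fl_reprK y).
by rewrite -fl_classZ -fl_classD !leval_class.
Qed.
HB.instance Definition _ g :=
  GRing.isLinear.Build K (freeLeibniz K) L _ (leval g) (leval_linear g).

Lemma levalM g f1 f2 : leval g (lmul f1 f2) = lmul (leval g f1) (leval g f2).
Proof.
by rewrite -(fl_reprK f1) -(fl_reprK f2) [X in leval g X]fl_mulE !leval_class.
Qed.

Lemma leval_unique g (h : {linear freeLeibniz K -> L}) :
    (forall f1 f2, h (lmul f1 f2) = lmul (h f1) (h f2)) ->
    (forall i, h (lvar K i) = g i) -> h =1 leval g.
Proof.
move=> hM hvar f; rewrite -(fl_reprK f) leval_class.
elim: (fl_repr f) => [i||s IHs t IHt|a s IHs|s IHs t IHt] /=.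
- exact: hvar.
- by rewrite fl_class0 linear0.
- by rewrite fl_classD linearD IHs IHt.
- by rewrite fl_classZ linearZ /= IHs.
- by rewrite -fl_mulE hM IHs IHt.
Qed.

(* The values f(a_1, ..., a_m); generators beyond x_m are sent to 0. *)
Definition limage (m : nat) f : set L :=
  range (fun a : m.-tuple L => leval (nth 0 a) f).

End Evaluation.

Arguments limage {K} L m f.

(* (... (u_1 u_2) ...) u_m; the value on the empty sequence is a dummy. *)
Definition lnormed (K : fieldType) (L : leibnizType K) (s : seq L) : L :=
  if s is u :: s' then foldl lmul u s' else 0.

Definition multilinear (K : fieldType) (m : nat) (f : freeLeibniz K) : Prop :=
  exists c : 'S_m -> K,
    f = \sum_(s : 'S_m) c s *: lnormed [seq lvar K (s i) | i : 'I_m].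

Definition is_basis (K : fieldType) (V : lmodType K) (e : nat -> V) : Prop :=
  (forall (n : nat) (c : nat -> K),
     \sum_(i < n) c i *: e i = 0 -> forall i, (i < n)%N -> c i = 0) /\
  lspan (range e) = [set: V].

(* [e i] stands for e_{i+1}. *)
Record is_Linf (K : fieldType) (L : leibnizType K) (e : nat -> L) : Prop := {
  Linf_basis : is_basis e;
  Linf_mul0 : forall i, lmul (e i) (e 0%N) = e i.+1;
  Linf_mulS : forall i j, lmul (e i) (e j.+1) = 0
}.

(* Existence of L_infty: on polynomials, with basis 'X^i. *)
Section LinfModel.
Context (K : fieldType).

Definition Linf_model : Type := {poly K}.
HB.instance Definition _ := GRing.Lmodule.on Linf_model.

Definition Linf_model_mul (p q : Linf_model) : Linf_model :=
  (q : {poly K})`_0 *: ((p : {poly K}) * 'X).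

Fact Linf_model_bilinear : bilinear_for *:%R *:%R Linf_model_mul.
Proof.
split=> z a x y; rewrite /Linf_model_mul /=.
  by rewrite mulrDl scalerDr -scalerAl !scalerA mulrC.
by rewrite coefD coefZ scalerDl scalerA.
Qed.

Fact Linf_model_leibniz (x y z : Linf_model) :
  Linf_model_mul x (Linf_model_mul y z) =
  Linf_model_mul (Linf_model_mul x y) z - Linf_model_mul (Linf_model_mul x z) y.
Proof.
rewrite /Linf_model_mul coefZ coefMX mulr0 scale0r.
by rewrite -!scalerAl !scalerA mulrC subrr.
Qed.
HB.instance Definition _ :=
  isLeibniz.Build K Linf_model Linf_model_bilinear Linf_model_leibniz.

Lemma Linf_modelP : @is_Linf K Linf_model (fun i => 'X^i : {poly K}).
Proof.
split=> [|i|i j].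
- split=> [n c|].
    have -> : \sum_(i < n) c i *: ('X^i : {poly K}) = \poly_(i < n) c i.
      by rewrite poly_def.
    by move=> h i ltin; have := congr1 (coefp i) h;
       rewrite /= coef_poly ltin coef0.
  apply/seteqP; split=> // p _ A [[A0 AL] sA].
  rewrite -[p](@coefK K) poly_def; elim/big_ind: _ => [|x y Ax Ay|i _].
  - by move: A0; rewrite inE.
  - have := AL 1 x y; rewrite !inE scale1r; exact.
  - have := AL p`_i 'X^i 0; rewrite !inE addr0; apply; last by rewrite inE in A0.
    by apply: sA; exists (val i).
- by rewrite /lmul /= /Linf_model_mul expr0 coefC eqxx scale1r exprSr.
- by rewrite /lmul /= /Linf_model_mul coefXn scale0r.
Qed.

End LinfModel.

(* Main.v *)
Require Import Defs.
From HB Require Import structures.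
From mathcomp Require Import all_boot all_order all_algebra all_fingroup.
From mathcomp Require Import boolp classical_sets.
Local Open Scope ring_scope.
Local Open Scope classical_set_scope.

Set Implicit Arguments.
Unset Strict Implicit.
Unset Printing Implicit Defensive.

Import GRing.Theory.

(** Write [R] for the right multiplication by [e 0], so that [R (e i)] is
    [e i.+1].  Every [x] in [L] has the form [c *: e 0 + R y], and right
    multiplication by such an [x] is [c *: R], because [R y] annihilates [L] on
    the right.  A left-normed product therefore depends on its first factor
    through a power of [R] and on each other factor through one scalar: on
    arguments [a_k] with scalars [l_k], the polynomial [f] of degree
    [m = n + 1] takes the value
      [\sum_j alpha_j (\prod_(k != j) l_k) R^n (a_j)],
    where [alpha_j] is the sum of the coefficients of the monomials of [f] that
    begin with [x_j] ([leval_multilinear]).  Moreover [L^(n + 1)] is the range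
    of [R^n] ([lpow_rmul]).

    So the image lies in [L^m].  Its part along [R^n (e 0)] has the coefficient
    [(\sum_j alpha_j) (\prod_k l_k)]; when [\sum_j alpha_j = 0], the image
    lies in [L^(m + 1)] ([leval_sum0]).  Conversely, if [alpha_j <> 0],
    putting [c *: e 0 + R y] in the slot [j] and [e 0] in all the others gives
    [R^n ((c * \sum_i alpha_i) *: e 0 + alpha_j *: R y)] ([leval_slot]), which
    runs over all of [L^m] if [\sum_i alpha_i <> 0] and over all of
    [L^(m + 1)] otherwise.  If all the [alpha_j] vanish, the image is [0]. *)

Section Subspaces.
Context {K : fieldType}.

Lemma vsubspace_range (V W : lmodType K) (h : {linear V -> W}) :
  vsubspace (range h).
Proof.
split=> [|a u v]; first by rewrite inE; exists 0; rewrite ?linear0.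
by rewrite !inE => -[x _ <-] [y _ <-]; exists (a *: x + y); rewrite ?linearP.
Qed.

Lemma lspan_sub (V : lmodType K) (A B : set V) :
  vsubspace B -> A `<=` B -> lspan A `<=` B.
Proof. by move=> sB AB x; apply; split. Qed.

Lemma sub_lspan (V : lmodType K) (A : set V) : A `<=` lspan A.
Proof. by move=> x Ax B [_]; apply. Qed.

End Subspaces.

Section RightPowers.
Context {K : fieldType} {L : leibnizType K}.
Implicit Types (x y z u v : L) (n : nat).

Definition rmul_iter z n x : L := iter n (lmul^~ z) x.

Lemma rmul_iter_linear z n : linear (rmul_iter z n).
Proof.
by rewrite /rmul_iter => a x y; elim: n => //= n ->; rewrite lmulDl lmulZl.
Qed.
HB.instance Definition _ z n :=
  GRing.isLinear.Build K L L _ (rmul_iter z n) (rmul_iter_linear z n).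

Lemma rmul_iterSr z n x : rmul_iter z n (lmul x z) = rmul_iter z n.+1 x.
Proof. by rewrite /rmul_iter iterSr. Qed.

Lemma foldl_lmul_scalar (I : Type) z (b : I -> L) (l : I -> K) (r : seq I) u :
    (forall i v, lmul v (b i) = l i *: lmul v z) ->
  foldl lmul u [seq b i | i <- r] =
    (\prod_(i <- r) l i) *: rmul_iter z (size r) u.
Proof.
move=> lb; elim: r u => [|i r IHr] u /=; first by rewrite big_nil scale1r.
by rewrite IHr lb big_cons linearZ /= scalerA rmul_iterSr mulrC.
Qed.

Lemma leval_foldl (g : nat -> L) (p : freeLeibniz K) s :
  leval g (foldl lmul p s) = foldl lmul (leval g p) [seq leval g q | q <- s].
Proof. by elim: s p => //= q s IHs p; rewrite IHs levalM. Qed.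

End RightPowers.

Lemma prod_perm_behead {K : fieldType} {n : nat} (s : 'S_n.+1)
    (l : 'I_n.+1 -> K) :
  \prod_(i < n) l (s (lift ord0 i)) = \prod_(k | k != s ord0) l k.
Proof.
rewrite (reindex_inj (@perm_inj _ s)) /=.
under [RHS]eq_bigl => i do rewrite (inj_eq (@perm_inj _ s)).
by rewrite [RHS]big_mkcond big_ord_recl eqxx /= mul1r.
Qed.

Definition head_coef {K : fieldType} {n : nat} (c : 'S_n.+1 -> K)
    (j : 'I_n.+1) : K :=
  \sum_(s : 'S_n.+1 | s ord0 == j) c s.

(** When every argument acts on the right as a scalar multiple of one and the
    same [z], the factors after the first enter a left-normed product only
    through their scalars, which commute; so the monomials that begin with the
    same variable take the same value and can be collected. *)
Lemma leval_multilinear {K : fieldType} {L : leibnizType K} (z : L) (n : nat)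
    (c : 'S_n.+1 -> K) (g : nat -> L) (l : 'I_n.+1 -> K) :
    (forall (i : 'I_n.+1) u, lmul u (g i) = l i *: lmul u z) ->
  leval g (\sum_s c s *: lnormed [seq lvar K (s i) | i : 'I_n.+1]) =
  \sum_j (head_coef c j * \prod_(k | k != j) l k) *: rmul_iter z n (g j).
Proof.
move=> lg; rewrite linear_sum.
rewrite (partition_big (fun s : 'S_n.+1 => s ord0) predT) //=.
apply: eq_bigr => j _; rewrite mulr_suml scaler_suml.
apply: eq_bigr => s /eqP sj; rewrite linearZ /= -scalerA; congr (_ *: _).
rewrite /image_mem enum_ordSl /= leval_foldl leval_var -!map_comp.
rewrite (eq_map (g := fun i => g (s (lift ord0 i)))); last first.
  by move=> i /=; rewrite leval_var.
rewrite (@foldl_lmul_scalar _ _ _ z _ (fun i => l (s (lift ord0 i)))) //.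
by rewrite -enumT size_enum_ord big_enum prod_perm_behead sj.
Qed.

Section Linf.
Context {K : fieldType} {L : leibnizType K} {e : nat -> L}.
Hypothesis Linf_L : is_Linf e.

Local Notation R := (rmul_iter (e 0)).

Lemma Linf_ind (B : set L) :
  vsubspace B -> (forall i, B (e i)) -> forall x, B x.
Proof.
move=> sB Be x; have : lspan (range e) x by rewrite (Linf_basis Linf_L).2.
by apply: lspan_sub => // _ [i _ <-].
Qed.

Lemma Linf_decomp x : exists c y, x = c *: e 0 + lmul y (e 0).
Proof.
apply: (Linf_ind (B := [set x | exists c y, x = c *: e 0 + lmul y (e 0)])).
  split=> [|a x1 x2]; rewrite !inE.
    by exists 0, 0; rewrite scale0r lmul0l addr0.
  move=> [c1 [y1 ->]] [c2 [y2 ->]].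
  exists (a * c1 + c2), (a *: y1 + y2).
  by rewrite lmulDl lmulZl scalerDr addrACA scalerDl scalerA.
case=> [|i]; first by exists 1, 0; rewrite scale1r lmul0l addr0.
by exists 0, (e i); rewrite scale0r add0r (Linf_mul0 Linf_L).
Qed.

Lemma Linf_lmul_succ u i : lmul u (e i.+1) = 0.
Proof.
apply: (Linf_ind (B := [set u | lmul u (e i.+1) = 0])) => [|j]; last first.
  exact: Linf_mulS.
split=> [|a x y]; rewrite !inE /= ?lmul0l //.
by rewrite lmulDl lmulZl => -> ->; rewrite scaler0 addr0.
Qed.

Lemma Linf_lmul_scalar u c y :
  lmul u (c *: e 0 + lmul y (e 0)) = c *: lmul u (e 0).
Proof.
rewrite lmulDr lmulZr [X in _ + X](_ : _ = 0) ?addr0 //.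
apply: (Linf_ind (B := [set y | lmul u (lmul y (e 0)) = 0])) => [|i].
  split=> [|a y1 y2]; rewrite !inE /= ?lmul0l ?lmul0r //.
  by rewrite lmulDl lmulZl lmulDr lmulZr => -> ->; rewrite scaler0 addr0.
by rewrite /= (Linf_mul0 Linf_L) Linf_lmul_succ.
Qed.

(** A product [lmul u v] is a multiple of [lmul u (e 0)], so the products that
    generate the next power already form a subspace. *)
Lemma lpow_rmul n : lpow L n.+1 = range (R n).
Proof.
rewrite /lpow /=; elim: n => [|n IHn].
  by apply/seteqP; split=> // x _; exists x.
rewrite iterS IHn; apply/seteqP; split=> [|_ [x _ <-]]; last first.
  by apply: sub_lspan; exists (R n x) => //; exists (e 0).
apply: lspan_sub; first exact: vsubspace_range.
move=> _ [_ [x _ <-] [v _ <-]]; have [c [y ->]] := Linf_decomp v.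
by exists (c *: x) => //; rewrite Linf_lmul_scalar linearZ.
Qed.

Section Image.
Context {n : nat} (c : 'S_n.+1 -> K).

Local Notation f := (\sum_s c s *: lnormed [seq lvar K (s i) | i : 'I_n.+1]).
Local Notation alpha := (head_coef c).

Lemma leval_range g : range (R n) (leval g f).
Proof.
have /choice [l /choice [y gE]] := fun i : 'I_n.+1 => Linf_decomp (g i).
have lg (i : 'I_n.+1) u : lmul u (g i) = l i *: lmul u (e 0).
  by rewrite gE Linf_lmul_scalar.
rewrite (leval_multilinear _ lg).
under eq_bigr do rewrite -linearZ.
by rewrite -linear_sum; eexists.
Qed.

(** The [e 0]-part of [g j] has the coefficient [l j], which completes
    [\prod_(k | k != j) l k] to a product that does not depend on [j]; the
    [R n (e 0)]-parts of the summands are thus proportional to the [alpha j]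
    and cancel. *)
Lemma leval_sum0 g : \sum_j alpha j = 0 -> range (R n.+1) (leval g f).
Proof.
move=> alpha0.
have /choice [l /choice [y gE]] := fun i : 'I_n.+1 => Linf_decomp (g i).
have lg (i : 'I_n.+1) u : lmul u (g i) = l i *: lmul u (e 0).
  by rewrite gE Linf_lmul_scalar.
exists (\sum_j (alpha j * \prod_(k | k != j) l k) *: y j) => //.
rewrite (leval_multilinear _ lg) linear_sum.
under [RHS]eq_bigr => j _.
  rewrite gE linearD linearZ /= rmul_iterSr scalerDr scalerA -mulrA.
  rewrite [_ * l j]mulrC -(bigD1 j (P := predT)) //.
  over.
rewrite big_split /= -scaler_suml -mulr_suml alpha0 mul0r scale0r add0r.
by apply: eq_bigr => j _; rewrite linearZ lmulZl.
Qed.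

(** The preimage has [d *: e 0 + lmul y (e 0)] in the slot [j] and [e 0] in all
    the others: every summand but the one of index [j] has the scalar [d] as a
    factor, and that one gets it from its own argument, so that the
    [e 0]-parts add up while only [alpha j] weights [lmul y (e 0)]. *)
Lemma leval_slot (j : 'I_n.+1) d y :
  limage L n.+1 f
    (R n ((d * \sum_i alpha i) *: e 0 + alpha j *: lmul y (e 0))).
Proof.
pose x := d *: e 0 + lmul y (e 0).
pose a := [tuple if i == j then x else e 0 | i < n.+1].
have aE (i : 'I_n.+1) : nth 0 a i = if i == j then x else e 0.
  by rewrite -tnth_nth tnth_mktuple.
exists a => //.
have la (i : 'I_n.+1) u :
    lmul u (nth 0 a i) = (if i == j then d else 1) *: lmul u (e 0).
  by rewrite aE; case: eqP; rewrite ?Linf_lmul_scalar ?scale1r.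
rewrite (leval_multilinear _ la).
rewrite (bigD1 j) //= aE eqxx big1 => [|k /negPf-> //]; rewrite mulr1.
under eq_bigr => i ij.
  (* the only scalar other than 1 is that of the slot [j], which is [d] *)
  rewrite aE (negPf ij) (bigD1 j) 1?eq_sym //= eqxx.
  rewrite big1 => [|k /andP[_ /negPf->] //].
  rewrite mulr1; over.
rewrite -scaler_suml -mulr_suml -!linearZ -linearD /x; congr (R n _).
rewrite [\sum_i alpha i](bigD1 j) //= scalerDr scalerA addrAC -scalerDl.
by rewrite mulrC mulrDr [_ * d]mulrC.
Qed.

Lemma limage_head_coef0 : (forall j, alpha j = 0) -> limage L n.+1 f = [set 0].
Proof.
have slot := leval_slot ord0 0 0.
move=> alpha0; apply/seteqP; split=> [_ [a _ <-]|_ ->]; last first.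
  by move: slot; rewrite mul0r scale0r lmul0l scaler0 addr0 linear0.
have /choice [l /choice [y aE]] := fun i : 'I_n.+1 => Linf_decomp (nth 0 a i).
have la (i : 'I_n.+1) u : lmul u (nth 0 a i) = l i *: lmul u (e 0).
  by rewrite aE Linf_lmul_scalar.
rewrite (leval_multilinear _ la) /=.
by apply: big1 => j _; rewrite alpha0 mul0r scale0r.
Qed.

Lemma limage_sum_neq0 : \sum_j alpha j != 0 -> limage L n.+1 f = lpow L n.+1.
Proof.
move=> S0; rewrite lpow_rmul; apply/seteqP; split=> [_ [a _ <-]|_ [x _ <-]].
  exact: leval_range.
have [j aj] : exists j, alpha j != 0.
  by apply: contra_notP (negP S0) => /forallNP al0; rewrite big1 // => j _;
     apply/eqP/negPn/negP/al0.
have [d [y ->]] := Linf_decomp x.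
have := leval_slot j (d / \sum_i alpha i) ((alpha j)^-1 *: y).
by rewrite divfK // lmulZl scalerA divff // scale1r.
Qed.

Lemma limage_sum0 (j : 'I_n.+1) :
  alpha j != 0 -> \sum_i alpha i = 0 -> limage L n.+1 f = lpow L n.+2.
Proof.
move=> aj S0; rewrite lpow_rmul; apply/seteqP; split=> [_ [a _ <-]|_ [y _ <-]].
  exact: leval_sum0.
have := leval_slot j 0 ((alpha j)^-1 *: y).
by rewrite mul0r scale0r add0r lmulZl scalerA divff // scale1r rmul_iterSr.
Qed.

End Image.
End Linf.

Theorem theorem20 (K : fieldType) (L : leibnizType K) (e : nat -> L)
    (Linf_L : is_Linf e) (m : nat) (m_gt0 : (0 < m)%N)
    (f : freeLeibniz K) (f_multilinear : multilinear m f) :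
  [\/ limage L m f = [set 0],
      limage L m f = lpow L m
    | limage L m f = lpow L m.+1] /\
  vsubspace (limage L m f).
Proof.
case: m m_gt0 f_multilinear => // n _ [c ->].
set A := limage _ _ _.
have dich : [\/ A = [set 0], A = lpow L n.+1 | A = lpow L n.+2].
  have [S0|S0] := eqVneq (\sum_j head_coef c j) 0; last first.
    by apply: Or32; exact: (limage_sum_neq0 Linf_L S0).
  have [al0|/existsNP[j /eqP aj]] := pselect (forall j, head_coef c j = 0).
    by apply: Or31; exact: (limage_head_coef0 Linf_L al0).
  by apply: Or33; exact: (limage_sum0 Linf_L aj S0).
split=> //; case: dich => ->; rewrite ?(lpow_rmul Linf_L).
- split=> [|a x y]; first by rewrite inE.
  by rewrite !inE => -> ->; rewrite scaler0 addr0.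
- exact: vsubspace_range.
- exact: vsubspace_range.
Qed.
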